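(* For all integers $k\ge3$ and $\ell\ge2$, $\widetilde{r}(\sigma_{k,\ell}) \le k^2\ell+15k\ell+2k-12$.
   Context: For integers $k\ge3$ and $\ell\ge2$, the spider $\sigma_{k,\ell}$ is the tree formed as the union of $k$ paths, each of length $\ell$ (i.e. $\ell$ edges), that share exactly one common endpoint. The online Ramsey game for a target graph $H$ is played between Builder and Painter on an infinite set of vertices, initially with no edges. In each round Builder adds a new edge between two vertices (forming the background graph $G$), and Painter immediately colors that edge red or blue. The online Ramsey number $\widetilde{r}(H)$ is the minimum number $m$ such that Builder has a strategy guaranteeing that, against any Painter strategy, after at most $m$ rounds $G$ contains a monochromatic (not necessarily induced) subgraph isomorphic to $H$. *)

(* Defs.v *)
From mathcomp Require Import all_boot.
Set Implicit Arguments.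
Unset Strict Implicit.
Unset Printing Implicit Defensive.

Record sgraph := SGraph {
  svertex :> finType;
  sedge : rel svertex;
  sedge_sym : symmetric sedge;
  sedge_irrefl : irreflexive sedge }.

(* [None] is the common endpoint of the legs; [Some (i, j)] is the vertex at
   distance [j.+1] from it on the i-th leg. *)
Definition spider_rel (k l : nat) (u v : option ('I_k * 'I_l)) : bool :=
  match u, v with
  | None, None => false
  | None, Some (_, j) => j == 0 :> nat
  | Some (_, j), None => j == 0 :> nat
  | Some (i, j), Some (i', j') =>
      (i == i') && ((j.+1 == j' :> nat) || (j'.+1 == j :> nat))
  end.

Lemma spider_rel_sym (k l : nat) : symmetric (@spider_rel k l).
Proof.
by move=> [[i j]|] [[i' j']|] //=; rewrite eq_sym orbC.
Qed.

Lemma spider_rel_irrefl (k l : nat) : irreflexive (@spider_rel k l).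
Proof. by move=> [[i j]|] //=; rewrite eqxx orbb gtn_eqF. Qed.

Definition spider (k l : nat) : sgraph :=
  SGraph (@spider_rel_sym k l) (@spider_rel_irrefl k l).

(* The board has vertex set [nat].  A history lists the coloured edges, most
   recent first; [(x, y)] and [(y, x)] stand for the same edge. *)
Definition color := bool.
Definition history := seq (nat * nat * color).

Definition colored (h : history) (c : color) (x y : nat) : bool :=
  ((x, y, c) \in h) || ((y, x, c) \in h).

Definition new_edge (h : history) (e : nat * nat) : Prop :=
  e.1 <> e.2 /\ forall c : color, ~~ colored h c e.1 e.2.

Definition builder := history -> nat * nat.
Definition painter := history -> nat * nat -> color.

(* Some new edge is available after every history, so asking for a legal move
   also after unreachable histories does not restrict Builder. *)
Definition legal_builder (B : builder) : Prop :=
  forall h : history, new_edge h (B h).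

Fixpoint play (B : builder) (P : painter) (n : nat) : history :=
  if n is n'.+1 then
    let h := play B P n' in (B h, P h (B h)) :: h
  else [::].

Definition mono_copy (H : sgraph) (h : history) : Prop :=
  exists (c : color) (f : H -> nat),
    injective f /\ forall u v : H, sedge u v -> colored h c (f u) (f v).

Definition builder_wins_within (H : sgraph) (m : nat) : Prop :=
  exists B : builder, legal_builder B /\
    forall P : painter, exists n : nat, n <= m /\ mono_copy H (play B P n).

Definition is_online_ramsey_number (H : sgraph) (r : nat) : Prop :=
  builder_wins_within H r /\
  forall m : nat, builder_wins_within H m -> r <= m.

(* Main.v *)
(** Builder first forces a monochromatic, say red, path of about [3kl] vertices.
    A vertex [u] outside the path with [k] red neighbours at positions congruent
    modulo [l] is the centre of a red spider, the legs being pieces of the path;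
    hence [u] has fewer than [k] red edges to each residue class.  Builder then
    grows a blue spider that alternates between path vertices and new vertices.
    Let [T] be [2k - 1] unused path vertices of one class, all joined to the
    current end [p] of a leg.  He joins a new vertex [u] to [T] and to one further
    vertex [x] of the class: as [p] and [u] together have at most [2k - 2] red
    edges to [T], some [v] in [T] is blue to both, the leg grows by [v] and [u],
    and [T - v + x] takes the role of [T].  Two edges of the spider thus cost [2k]
    rounds, plus one to keep the centre joined to [T], so that a new leg can start
    at any time.  A class serves for [k] such steps. *)

Require Import Defs.
From mathcomp Require Import all_boot.
From mathcomp Require Import zify.
From Stdlib Require Import Classical ClassicalEpsilon.
Set Implicit Arguments.
Unset Strict Implicit.
Unset Printing Implicit Defensive.

(** * Coloured edges and the supply of new edges *)

Lemma colored_sym (h : history) (c : color) (x y : nat) :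
  colored h c x y = colored h c y x.
Proof. by rewrite /colored orbC. Qed.

Lemma colored_subset (h h' : history) (c : color) (x y : nat) :
  {subset h <= h'} -> colored h c x y -> colored h' c x y.
Proof. by move=> hh /orP[/hh hc|/hh hc]; apply/orP; [left|right]. Qed.

Lemma exists_notin (s : seq nat) : exists x, x \notin s.
Proof.
exists (\max_(y <- s) y).+1; apply/negP => hin.
by have := @leq_bigmax_seq _ s xpredT id _ hin isT; rewrite ltnn.
Qed.

Lemma exists_new_edge (h : history) : exists e, new_edge h e.
Proof.
have [x hx] := exists_notin (0 :: unzip1 (unzip1 h) ++ unzip2 (unzip1 h)).
exists (0, x); split=> /= [h0|c]; first by rewrite -h0 in_cons in hx.
move: hx; rewrite in_cons mem_cat !negb_or => /and3P[_ hx1 hx2].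
apply/andP; split; apply/negP => hin.
  by case/negP: hx2; apply/mapP; exists (0, x) => //; apply/mapP; exists (0, x, c).
by case/negP: hx1; apply/mapP; exists (x, 0) => //; apply/mapP; exists (x, 0, c).
Qed.

(** * Winning positions and the strategies that they yield *)

(** The game is unfolded as a tree of moves, with no mention of strategies, so that Builder's play
    can be described one round at a time. *)
Fixpoint force (W : history -> Prop) (m : nat) (h : history) : Prop :=
  W h \/ (if m is m'.+1 then
            exists e, new_edge h e /\ forall c, force W m' ((e, c) :: h)
          else False).

Lemma force_now (W : history -> Prop) (m : nat) (h : history) : W h -> force W m h.
Proof. by case: m => [|m]; left. Qed.

Lemma force_leq (W : history -> Prop) (m m' : nat) (h : history) :
  m <= m' -> force W m h -> force W m' h.
Proof.
elim: m m' h => [|m IH] m' h; first by move=> _ [|//]; apply: force_now.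
case: m' => // m' le_mm' [?|[e [he H]]]; first exact: force_now.
by right; exists e; split=> // c; apply: IH (H c).
Qed.

Lemma force_builder_wins (H : sgraph) (m : nat) :
  force (mono_copy H) m [::] -> builder_wins_within H m.
Proof.
move=> H0.
(* A good move keeps the win within the remaining budget whenever some move does. Since [size h] is
   the number of rounds played, the budget can be read off the history, and choosing a good move
   everywhere defines Builder's strategy. *)
pose good h e := new_edge h e /\
  ((exists e', new_edge h e' /\
      forall c, force (mono_copy H) (m - (size h).+1) ((e', c) :: h)) ->
   forall c, force (mono_copy H) (m - (size h).+1) ((e, c) :: h)).
have good_ex h : exists e, good h e.
  case: (classic (exists e', new_edge h e' /\
      forall c, force (mono_copy H) (m - (size h).+1) ((e', c) :: h))).
    by move=> [e [he hf]]; exists e; split.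
  by move=> nex; have [e he] := exists_new_edge h; exists e; split.
pose B h := proj1_sig (constructive_indefinite_description _ (good_ex h)).
have hB h : good h (B h) by rewrite /B; case: constructive_indefinite_description.
exists B; split=> [h|P]; first by case: (hB h).
have size_play n : size (play B P n) = n by elim: n => //= n ->.
have key n : n <= m -> (exists2 n', n' <= m & mono_copy H (play B P n')) \/
    force (mono_copy H) (m - n) (play B P n).
  elim: n => [|n IH] hn; first by right; rewrite subn0.
  case: (IH (ltnW hn)) => [|hf]; first by left.
  have em : m - n = (m - n.+1).+1 by lia.
  move: hf; rewrite em => -[hw|hf]; first by left; exists n => //; lia.
  right; have [_ /(_ _)] := hB (play B P n); rewrite size_play; exact.
case: (key m (leqnn m)) => [[n hn hw]|]; first by exists n.
by rewrite subnn => -[hw|//]; exists m.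
Qed.

Lemma online_ramsey_number_exists (H : sgraph) (m : nat) :
  builder_wins_within H m -> exists r, is_online_ramsey_number H r /\ r <= m.
Proof.
elim/ltn_ind: m => m IH hm.
case: (classic (exists2 m', m' < m & builder_wins_within H m')).
  by move=> [m' lt_m'm /(IH _ lt_m'm)[r [hr le_rm']]]; exists r; split=> //; lia.
move=> nex; exists m; split=> //; split=> // m' hm'.
by rewrite leqNgt; apply/negP => lt_m'm; apply: nex; exists m'.
Qed.

(* An edge that has already been drawn costs no round, so Builder may ask for
   the colour of any pair of distinct vertices. *)
Lemma force_query (W : history -> Prop) (m : nat) (h : history) (x y : nat) :
  x <> y ->
  (forall h' c, {subset h <= h'} -> colored h' c x y -> force W m h') ->
  force W m.+1 h.
Proof.
move=> xy H.
case: (classic (exists c, colored h c x y)) => [[c hc]|nex].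
  by apply: (force_leq (leqnSn m)); apply: (H h c).
right; exists (x, y); split.
  by split=> // c; apply/negP => hc; apply: nex; exists c.
move=> c; apply: (H _ c); first by move=> z hz; rewrite in_cons hz orbT.
by rewrite /colored in_cons eqxx.
Qed.

Definition revealed (h : history) (x y : nat) : Prop := exists c, colored h c x y.

Lemma revealed_subset (h h' : history) (x y : nat) :
  {subset h <= h'} -> revealed h x y -> revealed h' x y.
Proof. by move=> hh [c hc]; exists c; apply: colored_subset hc. Qed.

(** As in all later forcing lemmas, the hypothesis carries the rest of the play with its own budget
    [m], so costs of successive phases add up. *)
Lemma force_query_seq (W : history -> Prop) (m : nat) (h : history) (x : nat)
    (s : seq nat) :
  x \notin s ->
  (forall h', {subset h <= h'} -> {in s, forall y, revealed h' x y} ->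
     force W m h') ->
  force W (size s + m) h.
Proof.
elim: s h => [|y s IH] h; first by move=> _; apply.
rewrite in_cons negb_or => /andP[/eqP xy xs] H; rewrite addSn.
apply: (force_query xy) => h1 c h_h1 hc; apply: IH => // h2 h1_h2 hs.
apply: H => [z /h_h1/h1_h2 //|z]; rewrite in_cons => /predU1P[->|/hs //].
by apply: (revealed_subset h1_h2); exists c.
Qed.

(** * Forcing a long monochromatic path *)

(** A path with [n] edges that changes colour at most once, at [j]; either arm may be empty. *)
Definition two_colored_path (h : history) (n : nat) : Prop :=
  exists (c : color) (j : nat) (p q : seq nat),
    [/\ uniq (j :: p ++ q), path (colored h c) j p, path (colored h (~~ c)) j q
      & size p + size q = n].

Lemma path_colored_rev (h : history) (c : color) (x y : nat) (p : seq nat) :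
  path (colored h c) x (rcons p y) = path (colored h c) y (rcons (rev p) x).
Proof.
rewrite -{1}[y]/(last y [:: y]) -rev_path belast_rcons last_rcons rev_cons.
by apply: eq_path => a b; rewrite colored_sym.
Qed.

Lemma path_colored_subset (h h' : history) (c : color) (x : nat) (p : seq nat) :
  {subset h <= h'} -> path (colored h c) x p -> path (colored h' c) x p.
Proof. by move=> hh; apply: sub_path => a b; apply: colored_subset. Qed.

(** Transfers distinctness of vertices to the reopened path: [y] is the old joint, [x] the pendant
    vertex, [a] and [b] are the free ends. *)
Lemma perm_reopen_pendant_left (T : eqType) (x y a b : T) (p q : seq T) :
  perm_eq (x :: y :: rcons p a ++ rcons q b)
    (b :: (a :: rcons (rcons (rev p) y) x) ++ rev q).
Proof.
apply/permP => P; rewrite /= !count_cat /= -!cats1 /= !count_cat /= !count_rev; lia.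
Qed.

Lemma perm_reopen_pendant_right (T : eqType) (x y a b : T) (p q : seq T) :
  perm_eq (x :: y :: rcons p a ++ rcons q b)
    (b :: (a :: rev p) ++ rcons (rcons (rev q) y) x).
Proof.
apply/permP => P; rewrite /= !count_cat /= -!cats1 /= !count_cat /= !count_rev; lia.
Qed.

(* Joining the two free ends closes a cycle, which a pendant edge at [j] allows
   to be reopened one edge longer. *)
Lemma force_two_colored_path_step (W : history -> Prop) (m n : nat) (h : history) :
  two_colored_path h n ->
  (forall h', {subset h <= h'} -> two_colored_path h' n.+1 -> force W m h') ->
  force W m.+2 h.
Proof.
move=> [c [j [p [q [huniq hp hq hsize]]]]] H.
have [z] := exists_notin (j :: p ++ q).
rewrite in_cons mem_cat !negb_or => /and3P[zj zp zq].
have jz : j <> z by apply/eqP; rewrite eq_sym.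
(* If an arm is empty, the path is monochromatic and ends at [j]; the edge to [z] lengthens it
   whatever its colour. *)
have nil_case c' p' : uniq (j :: p') -> path (colored h c') j p' ->
    size p' = n -> z \notin p' -> force W m.+2 h.
  move=> u' path' size' zp'; apply: (force_leq (leqnSn _)).
  apply: (force_query jz) => h' d hh' hd; apply: (H _ hh').
  case: (eqVneq d c') hd => [->|/negPf dc] hd.
    exists c', z, (j :: p'), [::]; split=> //=; last by rewrite size' addn0.
      by rewrite cats0 in_cons negb_or zj zp'.
    by rewrite colored_sym hd; apply: path_colored_subset path'.
  exists c', j, p', [:: z]; split.
  - by rewrite -cat_cons cats1 rcons_uniq u' andbT in_cons negb_or zj zp'.
  - exact: path_colored_subset path'.
  - by rewrite /= andbT; move: dc hd; case: (d); case: (c').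
  - by rewrite addn1 size'.
case/lastP: p huniq hp hsize zp => [|p a] huniq hp hsize zp.
  exact: (nil_case (~~ c) q).
case/lastP: q huniq hq hsize zq => [|q b] huniq hq hsize zq.
  apply: (nil_case c (rcons p a)) => //; last by rewrite -hsize addn0.
  by rewrite cats0 in huniq.
have ab : a <> b.
  move=> ab; move: huniq; rewrite /= cat_uniq => /and3P[_ _ /andP[/hasPn/(_ b)]].
  by rewrite !mem_rcons !in_cons ab eqxx => /(_ isT).
apply: (force_query ab) => h1 d h_h1 hab; apply: (force_query jz) => h2 d' h1_h2 hjz.
have h_h2 : {subset h <= h2} by move=> x /h_h1/h1_h2.
apply: (H _ h_h2).
have {}hab := colored_subset h1_h2 hab.
have {}hp := path_colored_subset h_h2 hp.
have {}hq := path_colored_subset h_h2 hq.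
(* Here [c'] is the colour of the closing edge, and the joint moves to [b']. The pendant edge
   lengthens the arm of its own colour, and the edge at [j] of the other colour is given up: two
   edges gained, one lost. *)
have wlog_case c' p' a' q' b' : uniq (j :: rcons p' a' ++ rcons q' b') ->
    path (colored h2 c') j (rcons p' a') ->
    path (colored h2 (~~ c')) j (rcons q' b') ->
    colored h2 c' b' a' -> z \notin rcons p' a' -> z \notin rcons q' b' ->
    (size p' + size q').+2 = n -> two_colored_path h2 n.+1.
  move=> u' path_p path_q hba zp' zq' size'.
  move: path_p path_q; rewrite (path_colored_rev _ _ j a') (path_colored_rev _ _ j b') => path_p path_q.
  have path_q' : path (colored h2 (~~ c')) b' (rev q').
    by move: path_q; rewrite rcons_path => /andP[].
  have path_p' : path (colored h2 c') a' (rev p').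
    by move: path_p; rewrite rcons_path => /andP[].
  case: (eqVneq d' c') hjz => [->|/negPf dc] hjz.
    exists c', b', (a' :: rcons (rcons (rev p') j) z), (rev q'); split=> //.
    - rewrite -(@perm_uniq _ (z :: j :: rcons p' a' ++ rcons q' b')).
        rewrite cons_uniq u' andbT in_cons mem_cat !negb_or zj zp'; exact: zq'.
      exact: perm_reopen_pendant_left.
    - by rewrite /= hba rcons_path path_p last_rcons.
    - by rewrite /= !size_rcons !size_rev -size'; clear; lia.
  exists c', b', (a' :: rev p'), (rcons (rcons (rev q') j) z); split=> //.
  - rewrite -(@perm_uniq _ (z :: j :: rcons p' a' ++ rcons q' b')).
      rewrite cons_uniq u' andbT in_cons mem_cat !negb_or zj zp'; exact: zq'.
    exact: perm_reopen_pendant_right.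
  - by rewrite /= hba path_p'.
  - by rewrite rcons_path path_q last_rcons; move: dc hjz; case: (d'); case: (c').
  - by rewrite /= !size_rcons !size_rev -size'; clear; lia.
move: hsize; rewrite !size_rcons addSn addnS => hsize.
case: (eqVneq d c) hab => [->|/negPf dc] hab.
  by apply: (wlog_case c p a q b) => //; rewrite colored_sym.
apply: (wlog_case (~~ c) q b p a) => //; rewrite ?negbK //; last by rewrite addnC.
  rewrite -(@perm_uniq _ (j :: rcons p a ++ rcons q b)) //.
  by rewrite perm_cons perm_catC.
by move: dc hab; case: (d); case: (c).
Qed.

(** After [2 * n] steps of two rounds each the path has [2 * n] edges, so one of its arms has at
    least [n] of them. *)
Lemma force_path (W : history -> Prop) (m n : nat) (h : history) :
  (forall h' c s, uniq s -> size s = n -> sorted (colored h' c) s -> force W m h') ->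
  force W (4 * n + m) h.
Proof.
move=> H.
have key d h' t : two_colored_path h' t -> t + d = 2 * n -> force W (2 * d + m) h'.
  elim: d h' t => [|d IH] h' t.
    move=> [c [j [p [q [huniq hp hq hsize]]]]]; rewrite addn0 muln0 add0n => ht.
    have take_case c' s : uniq (j :: s) -> path (colored h' c') j s -> n <= size s ->
        force W m h'.
      move=> us path_s le_ns; apply: (H h' c' (take n (j :: s))).
      - exact: take_uniq.
      - by rewrite size_take /=; case: ltnP => //; lia.
      - exact: take_sorted.
    case: (leqP n (size p)) => [|lt_pn].
      apply: take_case hp; move: huniq; rewrite -cat_cons cat_uniq; by case/andP.
    apply: (take_case _ q _ hq); last by lia.
    by apply: subseq_uniq huniq; rewrite /= eqxx suffix_subseq.
  move=> ht htd; rewrite mulnS addSn addSn.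
  by apply: (force_two_colored_path_step ht) => h2 _ ht2; apply: (IH _ t.+1) => //; lia.
rewrite (_ : 4 * n = 2 * (2 * n)); last by lia.
by apply: (key _ _ 0) => //; exists true, 0, [::], [::].
Qed.

(** * Spiders on the board and residue classes of a path *)

Lemma mono_copy_spider (h : history) (c : color) (k l u : nat) (g : nat -> nat -> nat) :
  (forall i j, i < k -> j < l -> g i j <> u) ->
  (forall i j i' j', i < k -> j < l -> i' < k -> j' < l -> g i j = g i' j' ->
     i = i' /\ j = j') ->
  (forall i, i < k -> 0 < l -> colored h c u (g i 0)) ->
  (forall i j, i < k -> j.+1 < l -> colored h c (g i j) (g i j.+1)) ->
  mono_copy (spider k l) h.
Proof.
move=> g_u g_inj g0 gS; exists c.
exists (fun v : option ('I_k * 'I_l) => if v is Some (i, j) then g i j else u).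
split=> [[[i j]|] [[i' j']|] //=|].
- move=> /(g_inj _ _ _ _ (ltn_ord i) (ltn_ord j) (ltn_ord i') (ltn_ord j'))[hi hj].
  by congr (Some (_, _)); apply: val_inj.
- by move/(g_u _ _ (ltn_ord i) (ltn_ord j)).
- by move/esym/(g_u _ _ (ltn_ord i') (ltn_ord j')).
move=> [[i j]|] [[i' j']|] //=.
- move=> /andP[/eqP <-] /orP[] /eqP hj.
    by rewrite -hj; apply: gS => //; rewrite hj.
  by rewrite colored_sym -hj; apply: gS => //; rewrite hj.
- by move=> /eqP hj; rewrite hj colored_sym; apply: g0 => //; rewrite -hj.
- by move=> /eqP hj; rewrite hj; apply: g0 => //; rewrite -hj.
Qed.

(* The vertices of [s] at positions congruent to [r] modulo [l]: each of them
   starts a piece of [s] with [l] vertices, and these pieces are disjoint. *)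
Definition class_vertex (l : nat) (s : seq nat) (r i : nat) : nat := nth 0 s (r + l * i).

Lemma block_position_inj (l a j b j' : nat) :
  j < l -> j' < l -> l * a + j = l * b + j' -> a = b /\ j = j'.
Proof.
move=> hj hj' e; have ab : a = b.
  have := congr1 (divn^~ l) e.
  by rewrite ![l * _]mulnC !divnMDl ?divn_small ?addn0 //; apply: leq_ltn_trans hj.
by split=> //; move/eqP: e; rewrite ab eqn_add2l => /eqP.
Qed.

Lemma block_position_ltn (l a j m : nat) : j < l -> a < m -> l * a + j < l * m.
Proof.
move=> hj ham; apply: (@leq_trans (l * a.+1)); first by rewrite mulnS addnC ltn_add2r.
by rewrite leq_mul2l ham orbT.
Qed.

Lemma class_vertex_inj (l : nat) (s : seq nat) (m r i r' i' : nat) :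
  uniq s -> r < l -> r' < l -> i < m -> i' < m ->
  r + l * m <= size s -> r' + l * m <= size s ->
  class_vertex l s r i = class_vertex l s r' i' -> r = r' /\ i = i'.
Proof.
move=> us hr hr' hi hi' hs hs' /eqP.
have le_l a : a < m -> l * a < l * m.
  by move=> ham; rewrite ltn_mul2l ham andbT; apply: leq_ltn_trans hr.
rewrite nth_uniq //; last 2 first.
- by apply: leq_trans hs; rewrite ltn_add2l le_l.
- by apply: leq_trans hs'; rewrite ltn_add2l le_l.
by move=> /eqP; rewrite ![_ + l * _]addnC => /(block_position_inj hr hr')[-> ->].
Qed.

Lemma class_vertex_mem (l : nat) (s : seq nat) (m r i : nat) :
  0 < l -> i < m -> r + l * m <= size s -> class_vertex l s r i \in s.
Proof.
move=> l0 him hs; apply: mem_nth; apply: leq_trans hs.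
by rewrite ltn_add2l ltn_mul2l l0.
Qed.

(** The bound on [size s] leaves room for a full piece of [l] vertices after each class vertex of
    index below [m], so [k] neighbours of [u] start [k] disjoint legs. *)
Lemma red_count_class (h : history) (c : color) (k l m r u : nat) (s I : seq nat) :
  uniq s -> sorted (colored h c) s -> u \notin s -> 0 < l -> r + l * m <= size s ->
  uniq I -> {in I, forall i, i < m} ->
  mono_copy (spider k l) h \/
  count (fun i => colored h c u (class_vertex l s r i)) I < k.
Proof.
move=> us path_s hu l0 hs uI hI.
set red := fun i => _; case: (ltnP (count red I) k) => [|hk]; [by right|left].
pose J := filter red I.
have sizeJ : k <= size J by rewrite size_filter.
have uJ : uniq J by apply: filter_uniq.
have hJ i : i < k -> nth 0 J i < m /\ red (nth 0 J i).
  move=> hi; have := mem_nth 0 (leq_trans hi sizeJ).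
  by rewrite mem_filter => /andP[? /hI].
have pos i j : i < k -> j < l -> r + l * nth 0 J i + j < size s.
  move=> hi hj; apply: leq_trans hs; rewrite -addnA ltn_add2l.
  by apply: block_position_ltn => //; case: (hJ _ hi).
apply: (@mono_copy_spider _ c _ _ u (fun i j => nth 0 s (r + l * nth 0 J i + j))).
- by move=> i j hi hj e; case/negP: hu; rewrite -e mem_nth ?pos.
- move=> i j i' j' hi hj hi' hj' /eqP; rewrite nth_uniq ?pos // -!addnA eqn_add2l.
  move=> /eqP /(block_position_inj hj hj')[/eqP e ->]; split=> //; apply/eqP.
  by rewrite -(nth_uniq 0 _ _ uJ) ?(leq_trans _ sizeJ).
- by move=> i hi _; rewrite addn0; case: (hJ _ hi).
- move=> i j hi hj; rewrite addnS; apply: (sortedP 0 path_s).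
  by rewrite -addnS pos.
Qed.

(** * The pigeonhole step and the growing blue spider *)

Lemma has_common_complement (T : eqType) (P Q : pred T) (s : seq T) (k : nat) :
  count P s < k -> count Q s < k -> size s = 2 * k - 1 ->
  exists2 x, x \in s & ~~ P x /\ ~~ Q x.
Proof.
move=> hP hQ hs.
have /allPn[x xs] : ~~ all (predU P Q) s.
  (* The two predicates together cover at most [2 * k - 2] entries. *)
  rewrite all_count; have := count_predUI P Q s; move: hP hQ hs; lia.
by rewrite /= negb_or => /andP[? ?]; exists x.
Qed.

(* The vertices of the blue spider are listed leg by leg: [vs] has those on the
   red path, [us] the others, and on each leg they alternate starting with [vs].
   A leg thus uses [uphalf l] consecutive entries of both lists; when [l] is odd
   the last entry of [us] is a dummy. *)
Definition leg_continues (l t : nat) : bool := (t %% uphalf l).*2.+1 < l.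

(** At [t = size us] this is the vertex from which the spider grows next. *)
Definition leg_pred (l u0 : nat) (us : seq nat) (t : nat) : nat :=
  if uphalf l %| t then u0 else nth 0 us t.-1.

Record partial_spider (h : history) (c : color) (l u0 : nat) (us vs : seq nat)
    (t : nat) : Prop := PartialSpider {
  ps_size_us : size us = t;
  ps_size_vs : size vs = t;
  ps_uniq_us : uniq (u0 :: us);
  ps_uniq_vs : uniq vs;
  ps_in : forall i, i < t -> colored h c (leg_pred l u0 us i) (nth 0 vs i);
  ps_out : forall i, i < t -> leg_continues l i -> colored h c (nth 0 vs i) (nth 0 us i) }.

Lemma partial_spider_subset (h h' : history) (c : color) (l u0 : nat)
    (us vs : seq nat) (t : nat) :
  {subset h <= h'} -> partial_spider h c l u0 us vs t -> partial_spider h' c l u0 us vs t.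
Proof.
move=> hh [? ? ? ? hin hout]; split=> // i hi.
  exact: colored_subset (hin i hi).
by move=> hl; apply: colored_subset (hout i hi hl).
Qed.

Lemma partial_spider_complete (h : history) (c : color) (k l u0 : nat) (us vs : seq nat) :
  {in u0 :: us, forall x, x \notin vs} ->
  partial_spider h c l u0 us vs (uphalf l * k) -> mono_copy (spider k l) h.
Proof.
move=> dis [size_us size_vs /= /andP[u0us uus] uvs hin hout].
pose q := uphalf l.
have half_q j : j < l -> j./2 < q by rewrite /q; lia.
have pos i j : i < k -> j < l -> q * i + j./2 < q * k.
  by move=> hi /half_q hj; apply: block_position_ltn.
have memU t : t < q * k -> nth 0 us t \in us by move=> ?; rewrite mem_nth ?size_us.
have memV t : t < q * k -> nth 0 vs t \in vs by move=> ?; rewrite mem_nth ?size_vs.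
have UV t t' : t < q * k -> t' < q * k -> nth 0 us t = nth 0 vs t' -> False.
  move=> ht ht' e; have hU : nth 0 us t \in u0 :: us by rewrite in_cons memU ?orbT.
  by have := dis _ hU; rewrite e memV.
have pos_inj i j i' j' : i < k -> j < l -> i' < k -> j' < l -> odd j = odd j' ->
    q * i + j./2 = q * i' + j'./2 -> i = i' /\ j = j'.
  move=> hi /half_q hj hi' /half_q hj' ho /(block_position_inj hj hj')[-> e].
  by split=> //; rewrite -(odd_double_half j) -(odd_double_half j') ho e.
have modq i j : j < l -> (q * i + j./2) %% q = j./2.
  by move=> /half_q hj; rewrite mulnC modnMDl modn_small.
(* Leg [i] occupies block [i] of both lists; the parity of [j] selects the list and [j./2] the place
   in the block. *)
apply: (@mono_copy_spider _ c _ _ u0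
  (fun i j => nth 0 (if odd j then us else vs) (q * i + j./2))).
- move=> i j hi hj; case: ifP => _ e.
    by case/negP: u0us; rewrite -e memU ?pos.
  by have := dis u0 (mem_head _ _); rewrite -e memV ?pos.
- move=> i j i' j' hi hj hi' hj'.
  case hoj: (odd j); case hoj': (odd j').
  + move=> /eqP; rewrite nth_uniq ?size_us ?pos // => /eqP.
    by apply: pos_inj; rewrite ?hoj ?hoj'.
  + by move/UV; case; apply: pos.
  + by move/esym/UV; case; apply: pos.
  + move=> /eqP; rewrite nth_uniq ?size_vs ?pos // => /eqP.
    by apply: pos_inj; rewrite ?hoj ?hoj'.
- move=> i hi l0 /=.
  have := hin (q * i + 0) (pos i 0 hi l0).
  by rewrite /leg_pred addn0 dvdn_mulr.
(* For odd [j] the next vertex is the following entry of [vs], joined by [hin]; for even [j] it is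
   the entry of [us] at the same place, joined by [hout]. *)
- move=> i j hi hj; rewrite /= uphalf_half; case hoj: (odd j) => /=.
    rewrite add1n addnS; have hj1 : j.+1./2 = j./2.+1 by rewrite /= uphalf_half hoj.
    have := hin (q * i + j./2).+1; rewrite -addnS -hj1 pos // /leg_pred.
    rewrite -/q /dvdn modq // hj1 /= addnS; exact.
  rewrite add0n; apply: hout; first by apply: pos => //; apply: ltnW.
  rewrite /leg_continues -/q modq; last exact: ltnW.
  by move: (odd_double_half j); rewrite hoj add0n => ->.
Qed.

(** * The invariant within a residue class *)

(** The bound [3 * k - 1] is the [2 * k - 1] vertices that open a class plus one replacement for
    each of its [k] steps. *)
Definition in_earlier_class (l k : nat) (s vs : seq nat) (r : nat) : Prop :=
  {in vs, forall v, exists r' i,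
    [/\ v = class_vertex l s r' i, i < 3 * k - 1 & r' < r]}.

(* Builder is in the [r]-th class, of which the first [2k - 1 + e] vertices have
   been in use; [T] indexes those of them that are not on the blue spider yet. *)
Record class_state (k l : nat) (c : color) (s : seq nat) (r e : nat) (h : history)
    (u0 : nat) (us vs T : seq nat) : Prop := ClassState {
  cs_sorted : sorted (colored h c) s;
  cs_spider : partial_spider h (~~ c) l u0 us vs (r * k + e);
  cs_outside : {in u0 :: us, forall x, x \notin s};
  cs_uniq : uniq T;
  cs_size : size T = 2 * k - 1;
  cs_bound : {in T, forall i, i < 2 * k - 1 + e};
  cs_used : {in vs, forall v, exists r' i,
    [/\ v = class_vertex l s r' i, i < 3 * k - 1
      & r' < r \/ [/\ r' = r, i \notin T & i < 2 * k - 1 + e]]};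
  cs_center : {in T, forall i, revealed h u0 (class_vertex l s r i)};
  cs_pred : {in T, forall i,
    revealed h (leg_pred l u0 us (r * k + e)) (class_vertex l s r i)} }.

Lemma leg_pred_mem (l u0 : nat) (us : seq nat) : 1 < l ->
  leg_pred l u0 us (size us) \in u0 :: us.
Proof.
move=> hl; rewrite /leg_pred; case: ifP => [_|hd]; first exact: mem_head.
rewrite in_cons mem_nth ?orbT //; case: (size us) hd => //.
by rewrite dvdn0.
Qed.

Lemma leg_pred_rcons (l u0 u t : nat) (us : seq nat) : size us = t ->
  forall i, i <= t -> leg_pred l u0 (rcons us u) i = leg_pred l u0 us i.
Proof.
move=> hs i hi; rewrite /leg_pred; case: ifP => // hd; rewrite nth_rcons.
have i0 : i != 0 by apply: contraFneq hd => ->; rewrite dvdn0.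
by have -> : i.-1 < size us by rewrite hs; lia.
Qed.

(** Only the last entry of a leg, for odd [l], can fail to continue; the next entry then starts a
    new leg at the centre. *)
Lemma leg_end_dvd (l t : nat) : 1 < l -> ~~ leg_continues l t -> uphalf l %| t.+1.
Proof.
rewrite /leg_continues => hl hc.
have q0 : 0 < uphalf l by lia.
have hm := ltn_pmod t q0.
have e : t %% uphalf l = (uphalf l).-1 by move: hc hm; set x := t %% _; lia.
by rewrite /dvdn -addn1 -modnDml e addn1 prednK // modnn.
Qed.

Lemma revealed_not_colored (h : history) (c : color) (x y : nat) :
  revealed h x y -> ~~ colored h c x y -> colored h (~~ c) x y.
Proof. by move=> [[] hd]; case: c => //; rewrite hd. Qed.

(** The part of a step that needs no move: all relevant colours are already revealed, and it remains
    to select [v]. *)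
Lemma class_state_step (k l : nat) (c : color) (s : seq nat) (r e : nat) (h : history)
    (u0 u : nat) (us vs T : seq nat) :
  1 < l -> 0 < k -> uniq s -> size s = l * (3 * k - 1) + uphalf l ->
  r < uphalf l -> e < k ->
  class_state k l c s r e h u0 us vs T -> u \notin u0 :: us ++ s ->
  revealed h u0 (class_vertex l s r (2 * k - 1 + e)) ->
  (leg_continues l (r * k + e) ->
    {in 2 * k - 1 + e :: T, forall i, revealed h u (class_vertex l s r i)}) ->
  mono_copy (spider k l) h \/
  exists vs' T', class_state k l c s r e.+1 h u0 (rcons us u) vs' T'.
Proof.
move=> hl k0 us_s size_s hr he St hu hx hcont.
have [path_s Sp out uT sT bT used center pre] := St.
have [size_us size_vs uus uvs hin hout] := Sp.
move: hu; rewrite in_cons mem_cat !negb_or => /and3P[u_u0 u_us u_s].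
set t := r * k + e in Sp size_us size_vs hin hout hcont pre *.
set x := 2 * k - 1 + e in hx hcont bT used *.
set p := leg_pred l u0 us t in pre.
have l0 : 0 < l by apply: ltnW.
have hrl r' : r' < uphalf l -> r' < l by move: hl; clear; lia.
have hrs r' : r' < uphalf l -> r' + l * (3 * k - 1) <= size s.
  by move=> hr'; rewrite size_s addnC leq_add2l ltnW.
have bT3 i : i \in T -> i < 3 * k - 1.
  by move=> /bT; rewrite /x; move: he k0; clear; lia.
have p_s : p \notin s by apply: out; rewrite /p -size_us leg_pred_mem.
case: (red_count_class k us_s path_s p_s l0 (hrs r hr) uT bT3) => [|cntp]; first by left.
(* The bound counts only red edges already drawn, so it also covers a dummy [u] whose edges were
   never asked. *)
case: (red_count_class k us_s path_s u_s l0 (hrs r hr) uT bT3) => [|cntu]; first by left.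
have [i iT [ip iu]] := has_common_complement cntp cntu sT.
set v := class_vertex l s r i in ip iu; right.
have xT : x \notin T by apply/negP => /bT; rewrite ltnn.
have ix : i != x by apply: contraNneq xT => <-.
(* A vertex of [vs] lies in an earlier class or has its index outside [T], whereas [i] is in [T]. *)
have v_vs : v \notin vs.
  apply/negP => /used[r' [i' [ev hi' hor]]].
  have hr' : r' < uphalf l by case: hor => [h1|[-> //]]; apply: ltn_trans h1 hr.
  have [er ei] := class_vertex_inj us_s (hrl _ hr) (hrl _ hr') (bT3 _ iT) hi'
    (hrs _ hr) (hrs _ hr') ev.
  case: hor => [|[_ hi'T _]]; first by rewrite er ltnn.
  by rewrite -ei iT in hi'T.
exists (rcons vs v), (x :: rem i T).
have memT' j : j \in x :: rem i T -> j = x \/ j \in T /\ j != i.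
  rewrite in_cons => /predU1P[->|]; first by left.
  by rewrite mem_rem_uniq // inE => /andP[? ?]; right.
have tS : r * k + e.+1 = t.+1 by rewrite addnS.
split; rewrite ?tS //.
- split.
  + by rewrite size_rcons size_us.
  + by rewrite size_rcons size_vs.
  + by rewrite -rcons_cons rcons_uniq uus in_cons negb_or u_u0 u_us.
  + by rewrite rcons_uniq v_vs.
  + move=> i'; rewrite ltnS => hi'; rewrite (leg_pred_rcons _ _ _ size_us) // nth_rcons size_vs.
    move: hi'; rewrite leq_eqVlt => /predU1P[->|hi']; last by rewrite hi' hin.
    by rewrite ltnn eqxx; apply: revealed_not_colored ip; apply: pre.
  + move=> i'; rewrite ltnS !nth_rcons size_vs size_us leq_eqVlt => /predU1P[->|hi'].
      rewrite ltnn eqxx => hc; rewrite colored_sym.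
      apply: revealed_not_colored iu; apply: (hcont hc).
      by rewrite in_cons iT orbT.
    by rewrite hi'; apply: hout.
- move=> y; rewrite -rcons_cons mem_rcons in_cons => /predU1P[-> //|]; exact: out.
- by rewrite /= rem_uniq // andbT; apply: contra xT; apply: mem_rem.
- by rewrite /= size_rem // sT; move: k0; clear; lia.
- by move=> j /memT'[->|[/bT hj _]]; rewrite addnS ltnS // ltnW.
- move=> y; rewrite mem_rcons in_cons => /predU1P[->|/used[r' [i' [ev hi' hor]]]].
    exists r, i; split; [by []|exact: bT3|right; split=> //].
      by apply/negP => /memT'[ei|[_]]; [rewrite ei eqxx in ix|rewrite eqxx].
    by rewrite addnS ltnS ltnW // bT.
  exists r', i'; split=> //; case: hor => [|[er hi'T hi'x]]; first by left.
  right; split=> //; last by rewrite addnS ltnS ltnW.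
  by apply/negP => /memT'[ei|[hT _]]; [rewrite ei ltnn in hi'x|rewrite hT in hi'T].
- by move=> j /memT'[->|[jT _]] //; apply: center.
(* The next end is either the centre, kept joined to the class by [center], or [u], which was then
   joined to [x] and all of [T]. *)
- move=> j /memT' hj; rewrite /leg_pred /= nth_rcons size_us ltnn eqxx.
  case: ifP => hd; first by case: hj => [->|[jT _]] //; apply: center.
  have hc : leg_continues l t by apply: contraFT hd; apply: leg_end_dvd.
  by apply: (hcont hc); rewrite in_cons; case: hj => [->|[-> _]]; rewrite ?eqxx ?orbT.
Qed.

Lemma class_state_subset (k l : nat) (c : color) (s : seq nat) (r e : nat)
    (h h' : history) (u0 : nat) (us vs T : seq nat) :
  {subset h <= h'} -> class_state k l c s r e h u0 us vs T ->
  class_state k l c s r e h' u0 us vs T.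
Proof.
move=> hh [path_s Sp ? ? ? ? ? center pre]; split=> //.
- by apply: sub_sorted path_s => a b; apply: colored_subset.
- exact: partial_spider_subset Sp.
- by move=> i /center; apply: revealed_subset.
- by move=> i /pre; apply: revealed_subset.
Qed.

(** * Builder's play through the classes and its cost *)

(** One round joins the centre to the replacement vertex; the other [2 * k] join the new vertex to
    it and to [T], and are saved when that vertex is a dummy. *)
Definition step_cost (k l t : nat) : nat := (2 * k * leg_continues l t).+1.

Lemma force_class_step (k l : nat) (c : color) (s : seq nat) (r e m : nat)
    (h : history) (u0 : nat) (us vs T : seq nat) :
  1 < l -> 0 < k -> uniq s -> size s = l * (3 * k - 1) + uphalf l ->
  r < uphalf l -> e < k ->
  class_state k l c s r e h u0 us vs T ->
  (forall h' u us' vs' T', {subset h <= h'} ->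
     class_state k l c s r e.+1 h' u us' vs' T' ->
     force (mono_copy (spider k l)) m h') ->
  force (mono_copy (spider k l)) (step_cost k l (r * k + e) + m) h.
Proof.
move=> hl k0 us_s size_s hr he St H.
have [_ _ out _ sT bT _ _ _] := St.
have [u hu] := exists_notin (u0 :: us ++ s).
have u_s : u \notin s.
  by move: hu; rewrite in_cons mem_cat !negb_or => /and3P[].
set x := 2 * k - 1 + e.
have cls i : i \in x :: T -> class_vertex l s r i \in s.
  move=> hi; apply: (@class_vertex_mem _ _ (3 * k - 1)); first exact: ltnW.
    move: hi; rewrite in_cons => /predU1P[->|/bT]; rewrite /x; move: he k0; clear; lia.
  by rewrite size_s addnC leq_add2l ltnW.
rewrite /step_cost addSn.
apply: (@force_query _ _ _ u0 (class_vertex l s r x)) => [e0|h1 d h_h1 hd].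
  by have := out u0 (mem_head _ _); rewrite e0 cls ?mem_head.
have hx1 : revealed h1 u0 (class_vertex l s r x) by exists d.
have fin h2 : {subset h1 <= h2} ->
    (leg_continues l (r * k + e) ->
      {in x :: T, forall i, revealed h2 u (class_vertex l s r i)}) ->
    force (mono_copy (spider k l)) m h2.
  move=> h1_h2 hcont.
  have h_h2 : {subset h <= h2} by move=> y /h_h1/h1_h2.
  have hx2 := revealed_subset h1_h2 hx1.
  case: (class_state_step hl k0 us_s size_s hr he (class_state_subset h_h2 St) hu hx2 hcont).
    exact: force_now.
  by move=> [vs' [T' St']]; apply: H St'.
case hc: (leg_continues l (r * k + e)); last first.
  by rewrite muln0; apply: fin => //; rewrite hc.
have <- : size [seq class_vertex l s r i | i <- x :: T] = 2 * k * true.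
  by rewrite size_map /= sT; move: k0; clear; lia.
apply: (@force_query_seq _ _ _ u) => [|h2 h1_h2 hq].
  by apply/mapP => -[i /cls hi eu]; move: u_s; rewrite eu hi.
by apply: fin => // _ i hi; apply: hq; apply: map_f.
Qed.

Lemma force_class (k l : nat) (c : color) (s : seq nat) (r m n : nat) :
  1 < l -> 0 < k -> uniq s -> size s = l * (3 * k - 1) + uphalf l -> r < uphalf l ->
  (forall h u0 us vs, sorted (colored h c) s ->
     partial_spider h (~~ c) l u0 us vs (r.+1 * k) ->
     {in u0 :: us, forall x, x \notin s} -> in_earlier_class l k s vs r.+1 ->
     force (mono_copy (spider k l)) m h) ->
  forall e h u0 us vs T, e + n = k -> class_state k l c s r e h u0 us vs T ->
  force (mono_copy (spider k l))
    (\sum_(r * k + e <= t < r.+1 * k) step_cost k l t + m) h.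
Proof.
move=> hl k0 us_s size_s hr H; elim: n => [|n IH] e h u0 us vs T.
  rewrite addn0 => -> [path_s Sp out _ _ _ used _ _].
  rewrite big_geq ?add0n; last by rewrite mulSn addnC.
  apply: (H _ u0 us vs) => //.
    by rewrite mulSn addnC.
  move=> v /used[r' [i [ev hi hor]]]; exists r', i; split=> //.
  by case: hor => [hr'|[-> //]]; apply: leqW.
move=> hen St.
have he : e < k by rewrite -hen -addn1 leq_add2l.
rewrite big_ltn; last by rewrite mulSn addnC ltn_add2r.
rewrite -addnA; apply: (force_class_step hl k0 us_s size_s hr he St).
move=> h' u us' vs' T' hh' St'; rewrite -addnS; apply: IH St'.
by rewrite addSnnS.
Qed.

(** With [k] steps in each, [uphalf l] classes supply exactly the [uphalf l * k] entries of a full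
    spider; a leg may run across several classes. Opening a class costs [2 * (2 * k - 1)] rounds,
    for the centre and the current end. *)
Lemma force_classes (k l : nat) (c : color) (s : seq nat) (n : nat) :
  1 < l -> 0 < k -> uniq s -> size s = l * (3 * k - 1) + uphalf l ->
  forall r h u0 us vs, r + n = uphalf l -> sorted (colored h c) s ->
  partial_spider h (~~ c) l u0 us vs (r * k) ->
  {in u0 :: us, forall x, x \notin s} -> in_earlier_class l k s vs r ->
  force (mono_copy (spider k l))
    (\sum_(r * k <= t < uphalf l * k) step_cost k l t + n * (2 * (2 * k - 1))) h.
Proof.
move=> hl k0 us_s size_s; elim: n => [|n IH] r h u0 us vs hrn path_s Sp out used.
  apply: force_now; move: hrn; rewrite addn0 => hr.
  apply: (@partial_spider_complete _ (~~ c) _ _ u0 us vs); last by rewrite -hr.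
  move=> y hy; apply/negP => /used[r' [i [ev hi hr']]].
  have := out y hy; rewrite ev (@class_vertex_mem _ _ (3 * k - 1)) //; first exact: ltnW.
  by rewrite size_s addnC leq_add2l -hr ltnW.
have hr : r < uphalf l by rewrite -hrn -addn1 leq_add2l.
pose T := iota 0 (2 * k - 1).
have cls i : i \in T -> class_vertex l s r i \in s.
  rewrite mem_iota add0n => hi; apply: (@class_vertex_mem _ _ (3 * k - 1)).
  - exact: ltnW.
  - by move: hi; clear; lia.
  - by rewrite size_s addnC leq_add2l ltnW.
set S := [seq class_vertex l s r i | i <- T].
have sizeS : size S = 2 * k - 1 by rewrite size_map size_iota.
have outS y : y \in u0 :: us -> y \notin S.
  by move=> /out hy; apply/mapP => -[i /cls hi ey]; move: hy; rewrite ey hi.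
have hp : leg_pred l u0 us (r * k) \in u0 :: us.
  by rewrite -(ps_size_us Sp) leg_pred_mem.
have -> : \sum_(r * k <= t < uphalf l * k) step_cost k l t + n.+1 * (2 * (2 * k - 1)) =
    size S + (size S + (\sum_(r * k + 0 <= t < r.+1 * k) step_cost k l t +
      (\sum_(r.+1 * k <= t < uphalf l * k) step_cost k l t + n * (2 * (2 * k - 1))))).
  rewrite (@big_cat_nat _ _ _ (r.+1 * k)) /= ?leq_mul2r ?leqnSn ?hr ?orbT //.
  rewrite addn0 sizeS; move: (\sum_(_ <= _ < _) _) (\sum_(_ <= _ < _) _) => a b.
  by clear; lia.
apply: force_query_seq (outS _ (mem_head _ _)) _ => h1 h_h1 h1S.
apply: force_query_seq (outS _ hp) _ => h2 h1_h2 h2S.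
have h_h2 : {subset h <= h2} by move=> y /h_h1/h1_h2.
apply: (@force_class _ _ c s r _ k hl k0 us_s size_s hr _ 0 h2 u0 us vs T) => //.
  by move=> h3 u us' vs'; apply: IH; rewrite addSnnS.
split=> //; rewrite ?addn0.
- by apply: sub_sorted path_s => a b; apply: colored_subset.
- exact: partial_spider_subset Sp.
- exact: iota_uniq.
- by rewrite size_iota.
- by move=> i; rewrite mem_iota add0n.
- by move=> v /used[r' [i [ev hi hr']]]; exists r', i; split=> //; left.
- move=> i hi; apply: (revealed_subset h1_h2); apply: h1S; exact: map_f.
- by move=> i hi; apply: h2S; apply: map_f.
Qed.

(** * Counting the rounds *)

(** In each block of [uphalf l] entries exactly the first [l./2] continue. *)
Lemma sum_leg_continues (l n : nat) : 1 < l ->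
  \sum_(0 <= t < uphalf l * n) leg_continues l t = n * l./2.
Proof.
move=> hl; elim: n => [|n IH]; first by rewrite muln0 big_geq.
rewrite mulnS addnC (@big_cat_nat _ _ _ (uphalf l * n)) //=; last exact: leq_addr.
rewrite IH mulSn addnC; congr (_ + _).
rewrite -{1}[uphalf l * n]add0n big_addn addKn.
rewrite (@eq_big_nat _ _ _ _ _ _ (fun b => (b < l./2) : nat)); last first.
  move=> b /andP[_ hb]; rewrite /leg_continues addnC mulnC modnMDl modn_small //.
  by congr nat_of_bool; clear; lia.
have hq : l./2 <= uphalf l by clear; lia.
rewrite (@big_cat_nat _ _ _ l./2) //= (@eq_big_nat _ _ _ _ _ _ (fun=> 1)).
  rewrite sum_nat_const_nat subn0 muln1 big_nat big1 ?addn0 // => b /andP[hb _].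
  by rewrite ltnNge hb.
by move=> b /andP[_ ->].
Qed.

Lemma step_cost_sum (k l : nat) : 1 < l ->
  \sum_(0 <= t < uphalf l * k) step_cost k l t = uphalf l * k + 2 * k * (k * l./2).
Proof.
move=> hl; under eq_bigr do rewrite /step_cost -addn1.
rewrite big_split /= -big_distrr /= sum_leg_continues // sum_nat_const_nat subn0 muln1.
exact: addnC.
Qed.

(** For even [l] the left side equals $k^2l+29kl/2-3l$; for odd [l] it is this plus
    $-k^2+5k/2+1$. *)
Lemma round_count (k l : nat) : 2 < k -> 1 < l ->
  4 * (l * (3 * k - 1) + uphalf l) +
    (uphalf l * k + 2 * k * (k * l./2) + uphalf l * (2 * (2 * k - 1))) <=
  k ^ 2 * l + 15 * k * l + 2 * k - 12.
Proof.
move=> hk hl; rewrite uphalf_half.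
have el := odd_double_half l; have a0 : 0 < l./2 by lia.
(* These substitutions build in the lower bounds on [k] and [l] and remove the truncated
   subtractions on the left. *)
have [j ->] : exists j, k = j + 3 by exists (k - 3); lia.
have [a ea] : exists a, l./2 = a.+1 by exists (l./2).-1; lia.
have -> : 3 * (j + 3) - 1 = 3 * j + 8 by lia.
have -> : 2 * (j + 3) - 1 = 2 * j + 5 by lia.
rewrite -[in l * _]el -[in _ ^ 2 * l]el -[in _ * (j + 3) * l]el ea.
case: (odd l); rewrite -muln2 expnS expn1; clear; nia.
Qed.

Theorem theorem6 (k l : nat) (hk : 3 <= k) (hl : 2 <= l) :
  exists r : nat, is_online_ramsey_number (spider k l) r /\
    r <= k ^ 2 * l + 15 * k * l + 2 * k - 12.
Proof.
apply: online_ramsey_number_exists; apply: force_builder_wins.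
have k0 : 0 < k by apply: leq_trans hk.
(* The path gets [l * (3 * k - 1) + uphalf l] vertices so that every class [r < uphalf l] has
   [3 * k - 1] complete pieces. *)
apply: (@force_leq _ (4 * (l * (3 * k - 1) + uphalf l) +
  (uphalf l * k + 2 * k * (k * l./2) + uphalf l * (2 * (2 * k - 1))))).
  exact: round_count.
apply: force_path => h c s us_s size_s path_s.
have [u0 hu0] := exists_notin s.
rewrite -step_cost_sum // -[X in index_iota X _](mul0n k).
(* The play starts from the empty spider, with any centre off the path. *)
apply: (@force_classes _ _ c s _ hl k0 us_s size_s 0 h u0 [::] [::]) => //.
by move=> x; rewrite mem_seq1 => /eqP ->.
Qed.
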